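(* Let $n$ and $r$ be positive integers with $n\ge 4$ and $r=2s$ for a positive integer $s$. Then $$\operatorname{mr}^-\left(P_n^{(r)}\right) = \begin{cases} n-r+1 & \text{if } 1 \le r \le n-3 \text{ and } n \text{ is odd},\\ n-r & \text{if } 1 \le r \le n-3,\ n=2t, \text{ and } t-s \text{ is even},\\ n-r+2 & \text{if } 1 \le r \le n-3,\ n=2t, \text{ and } t-s \text{ is odd},\\ 4 & \text{if } r \ge n-2.\end{cases}$$
   Context: All graphs are simple (finite, loopless, undirected). For a graph $G$ on vertex set $\{1,\dots,n\}$, let $\mathcal{S}^-(G)$ be the set of real $n\times n$ skew-symmetric matrices $A=[a_{ij}]$ such that for $i\neq j$, $a_{ij}\neq 0$ if and only if $ij$ is an edge of $G$. The minimum skew rank of $G$ is $\operatorname{mr}^-(G)=\min\{\operatorname{rank}(A): A\in\mathcal{S}^-(G)\}$. $P_n$ denotes the path with vertex set $\{1,\dots,n\}$ where $ij$ is an edge iff $|i-j|=1$. For a positive integer $r$, the strict power $G^{(r)}$ is the simple graph on the same vertex set in which distinct vertices $i,j$ are adjacent iff there is a walk in $G$ from $i$ to $j$ of length exactly $r$ (walks may repeat vertices and edges). *)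

(* Defs.v *)
(* MathComp with MathComp-Analysis (for the real numbers, R : realType). *)
From HB Require Import structures.
From mathcomp Require Import all_boot all_order all_algebra.
From mathcomp Require Import boolp classical_sets reals.

Set Implicit Arguments.
Unset Strict Implicit.
Unset Printing Implicit Defensive.

Import GRing.Theory.

Record sgraph (V : finType) := SGraph {
  adj :> rel V;
  adj_sym : symmetric adj;
  adj_irr : irreflexive adj }.

(* Vertices are 0, ..., n-1 rather than 1, ..., n. *)
Definition path_adj (n : nat) : rel 'I_n := fun i j => `|i - j|%N == 1.

Lemma path_adj_sym n : symmetric (@path_adj n).
Proof. by move=> i j; rewrite /path_adj distnC. Qed.

Lemma path_adj_irr n : irreflexive (@path_adj n).
Proof. by move=> i; rewrite /path_adj subrr. Qed.

Definition path_graph (n : nat) : sgraph 'I_n :=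
  SGraph (@path_adj_sym n) (@path_adj_irr n).

(* The tuple p lists the vertices of the walk after its starting point i, so
   its size is the number of edges traversed. *)
Definition has_walk (V : finType) (G : sgraph V) (r : nat) : rel V :=
  fun i j => [exists p : r.-tuple V, path G i p && (last i p == j)].

Definition strict_power_adj (V : finType) (G : sgraph V) (r : nat) : rel V :=
  fun i j => (i != j) && has_walk G r i j.

Lemma has_walk_rev (V : finType) (G : sgraph V) r i j :
  has_walk G r i j -> has_walk G r j i.
Proof.
case/existsP=> p /andP[Gp /eqP lp].
have sz : size (rev (belast i p)) == r by rewrite size_rev size_belast size_tuple.
apply/existsP; exists (Tuple sz); apply/andP; split => /=.
  rewrite -lp rev_path; rewrite (eq_path (e' := G)) // => x y.
  exact: adj_sym.
case: (tval p) lp => [|x q] /= lp; first by rewrite lp.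
by rewrite rev_cons last_rcons.
Qed.

Lemma strict_power_adj_sym (V : finType) (G : sgraph V) r :
  symmetric (strict_power_adj G r).
Proof.
move=> i j; rewrite /strict_power_adj eq_sym; congr (_ && _).
by apply/idP/idP; apply: has_walk_rev.
Qed.

Lemma strict_power_adj_irr (V : finType) (G : sgraph V) r :
  irreflexive (strict_power_adj G r).
Proof. by move=> i; rewrite /strict_power_adj eqxx. Qed.

Definition strict_power (V : finType) (G : sgraph V) (r : nat) : sgraph V :=
  SGraph (strict_power_adj_sym G r) (strict_power_adj_irr G r).

Local Open Scope ring_scope.
Local Open Scope classical_set_scope.

Definition skew_matrices (R : realType) (n : nat) (G : sgraph 'I_n) :
    set 'M[R]_n :=
  [set A | A^T = - A /\ forall i j, i != j -> (A i j != 0) = G i j].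
Arguments skew_matrices : clear implicits.
Arguments skew_matrices R {n} G.

Definition skew_rank (R : realType) (n : nat) (G : sgraph 'I_n) : pred nat :=
  fun k => `[< exists2 A : 'M[R]_n, skew_matrices R G A & \rank A = k >].

Lemma skew_rank_ex (R : realType) (n : nat) (G : sgraph 'I_n) :
  exists k, skew_rank R G k.
Proof.
pose A : 'M[R]_n :=
  \matrix_(i, j) (if G i j then (if (i < j)%N then 1 else - 1) else 0).
exists (\rank A); apply/asboolP; exists A => //; split.
  apply/matrixP=> i j; rewrite !mxE adj_sym.
  case: ifP => [Gij|_]; last by rewrite oppr0.
  case: ltngtP => [_|_|/val_inj eji]; rewrite ?opprK //.
  by rewrite eji adj_irr in Gij.
move=> i j _; rewrite mxE; case: (G i j); last by rewrite eqxx.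
by case: ifP; rewrite ?oppr_eq0 oner_neq0.
Qed.

Definition min_skew_rank (R : realType) (n : nat) (G : sgraph 'I_n) : nat :=
  ex_minn (skew_rank_ex R G).

(* Main.v *)
Require Import Defs.
From mathcomp Require Import all_boot all_order all_algebra.
From mathcomp Require Import boolp classical_sets reals.
From mathcomp Require Import zify.

Import Order.TTheory GRing.Theory Num.Theory.

(** For [r = 2s] the power splits into the even and the odd vertices, and on each
class of [m] vertices it is the band graph: [u ~ v] iff [0 < |u - v| <= s].
Lower bound: the rank of the block on a class is even, positive, and at least
[m - s] because of a triangular submatrix with nonzero diagonal.
Upper bound: a band matrix on [m + 2] vertices is obtained from one on [m]
vertices by prepending two indices and adding a single wedge [x y^T - y x^T], so
that the rank grows by 2; the base case, at most [s + 2] vertices, has rank 2. *)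

(** * Walks in the path and the adjacency of its even powers *)

Lemma path_adjE n (i j : 'I_n) :
  path_adj i j = (i == j.+1 :> nat) || (j == i.+1 :> nat).
Proof. by rewrite /path_adj; lia. Qed.

(** A step changes the position by one, hence also its parity. Conversely a walk is built one step
    at a time, keeping the target within reach. *)
Lemma path_graph_walkE n r (i j : 'I_n) : 1 < n ->
  has_walk (path_graph n) r i j = [&& i <= j + r, j <= i + r & ~~ odd (i + j + r)].
Proof.
move=> n1; apply/existsP/idP => [[p /andP[+ /eqP <-]]|].
  have sub (q : seq 'I_n) : path (path_graph n) i q ->
      [&& i <= last i q + size q, last i q <= i + size q
        & ~~ odd (i + last i q + size q)].
    elim: q i {p} => [|k q IH] i; first by move=> _ /=; lia.
    rewrite [path _ _ _]/= path_adjE => /andP[ik /IH].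
    by rewrite [last _ (_ :: _)]/= [size (_ :: _)]/=; lia.
  by move=> /sub; rewrite size_tuple.
suff: [&& i <= j + r, j <= i + r & ~~ odd (i + j + r)] ->
    exists p : seq 'I_n, [/\ size p = r, path (path_graph n) i p & last i p = j].
  move=> H /H [p [/eqP sp pp lp]]; exists (Tuple sp) => /=.
  by rewrite pp lp eqxx.
elim: r i => [|r IH] i h.
  by exists [::]; split=> //; apply: val_inj => /=; lia.
have [k [ik hk]] : exists k : 'I_n, path_graph n i k /\
    [&& k <= j + r, j <= k + r & ~~ odd (k + j + r)].
  (* Go up if [i < j], otherwise down; from [i = 0] the step goes to vertex 1, which exists since
     [1 < n]. *)
  have [ij|ji] := ltnP i j.
    have lt : i.+1 < n by have := ltn_ord j; lia.
    by exists (Ordinal lt); rewrite /= path_adjE /=; split; lia.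
  have [i0|i0] := posnP i.
    by exists (Ordinal n1); rewrite /= path_adjE /=; split; lia.
  have lt : i.-1 < n by have := ltn_ord i; lia.
  by exists (Ordinal lt); rewrite /= path_adjE /=; split; lia.
have [p [sp pp lp]] := IH k hk.
by exists (k :: p); split; [rewrite /= sp | apply/andP | ].
Qed.

Definition band (s i j : nat) : bool := [&& i != j, i <= j + s & j <= i + s].

Lemma strict_power_pathE n s (i j : 'I_n) : 1 < n ->
  strict_power (path_graph n) (2 * s) i j = (odd i == odd j) && band s i./2 j./2.
Proof.
move=> n1; rewrite /= /strict_power_adj path_graph_walkE // /band.
by rewrite -(inj_eq val_inj) /=; lia.
Qed.

Local Open Scope ring_scope.

(** * Ranks over a field: parity, lower bounds and wedge sums *)

Section SkewRank.
Variable F : numFieldType.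

(* For M a left inverse of a column basis C, A = C (M A M^T) C^T, so the skew
   matrix M A M^T of order rank A is invertible, hence of even order. *)
Lemma skew_rank_even n (A : 'M[F]_n) : A^T = - A -> ~~ odd (\rank A).
Proof.
move=> skA; set C := col_base A; set B := row_base A.
have /row_fullP[M MC] : row_full C := col_base_full A.
have defA : A = C *m B by rewrite mulmx_base.
have freeB : row_free B := row_base_free A.
clearbody C B.
have eqB : B = M *m A.
  by have := congr1 (mulmx M) defA; rewrite mulmxA MC mul1mx.
pose N := M *m A *m M^T.
have skN : N^T = - N.
  by rewrite /N !trmx_mul trmxK skA mulNmx mulmxN mulmxA.
have eqBN : B = N *m C^T.
  apply: trmx_inj; rewrite trmx_mul trmxK skN eqB trmx_mul skA mulNmx mulmxN.
  by congr (- _); rewrite /N -eqB mulmxA -defA.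
have uN : N \in unitmx.
  rewrite -row_free_unit /row_free eqn_leq rank_leq_row /=.
  rewrite -[X in (X <= _)%N](eqP freeB).
  by rewrite [in X in (X <= _)%N]eqBN mxrankM_maxl.
have : \det N^T = (-1) ^+ \rank A * \det N by rewrite skN -scaleN1r detZ.
rewrite det_tr; apply: contraPN => od; rewrite -signr_odd od expr1 mulN1r.
move: uN; rewrite unitmxE unitfE => d0 /eqP.
by rewrite -addr_eq0 -mulr2n mulrn_eq0 /= (negPf d0).
Qed.

(** The submatrix picked by [f] and [g] is lower triangular and invertible, and it is [A] multiplied
    by selection matrices, which cannot raise the rank. *)
Lemma rank_ge_triangular (m n k : nat) (A : 'M[F]_(m, n))
    (f : 'I_k -> 'I_m) (g : 'I_k -> 'I_n) :
  (forall i, A (f i) (g i) != 0) ->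
  (forall i j : 'I_k, (i < j)%N -> A (f i) (g j) = 0) -> (k <= \rank A)%N.
Proof.
move=> diag up; pose T := mxsub f g A.
have uT : T \in unitmx.
  rewrite unitmxE det_trig; last first.
    by apply/is_trig_mxP => i j ij; rewrite mxE up.
  by rewrite unitfE; apply/prodf_neq0 => i _; rewrite mxE.
rewrite -[X in (X <= _)%N](mxrank_unit uT) /T.
have -> : mxsub f g A = rowsub f 1%:M *m A *m colsub g 1%:M.
  by rewrite mul_rowsub_mx mul1mx mulmx_colsub mulmx1 -mxsubcr.
exact: leq_trans (mxrankM_maxl _ _) (mxrankM_maxr _ _).
Qed.


(** The row space of [A] is the direct sum of those of [P *m A] and [Q *m A]: a common vector is
    fixed by [P] and killed by it, since [Q *m P = 0]. *)
Lemma rank_proj_split n (A P Q : 'M[F]_n) :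
  P + Q = 1%:M -> P *m P = P -> P *m A = A *m P -> Q *m A = A *m Q ->
  \rank A = (\rank (P *m A) + \rank (Q *m A))%N.
Proof.
move=> PQ PP PA QA; rewrite -mxrank_disjoint_sum.
  apply: eqmx_rank; rewrite addsmx_sub !submxMl !andbT.
  by rewrite -[X in (X <= _)%MS]mul1mx -PQ mulmxDl addmx_sub_adds.
have QP : Q *m P = 0.
  have -> : Q = 1%:M - P by rewrite -PQ addrC addKr.
  by rewrite mulmxBl mul1mx PP subrr.
apply/eqP/rowV0P => v; rewrite sub_capmx => /andP[/submxP[x vx] /submxP[y vy]].
have -> : v = v *m P by rewrite vx PA -!mulmxA PP.
by rewrite vy QA -!mulmxA QP !mulmx0.
Qed.

(** Entry of a sum of [k] matrices [x y^T - y x^T], so of rank at most [2k]. Indices in [nat] can be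
    shifted without casts when the order grows. *)
Definition wedge_sum (k : nat) (x y : nat -> nat -> F) (i j : nat) : F :=
  \sum_(l < k) (x l i * y l j - y l i * x l j).

Lemma wedge_sum0 k x y i j :
  (forall l, x l i = 0) -> (forall l, y l i = 0) -> wedge_sum k x y i j = 0.
Proof.
by move=> x0 y0; apply: big1 => l _; rewrite x0 y0 !mul0r subrr.
Qed.

Lemma wedge_sumC k x y i j : wedge_sum k x y i j = - wedge_sum k x y j i.
Proof. by rewrite -sumrN; apply: eq_bigr => l _; rewrite opprB mulrC [y l i * _]mulrC. Qed.

(** Any [t] exceeding every [|a i j|] works. *)
Lemma big_nat_bound (m : nat) (a : nat -> nat -> F) :
  exists2 t : F, t != 0 &
    forall i j, (i < m)%N -> (j < m)%N -> (a i j + t != 0) && (a i j - t != 0).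
Proof.
pose t := 1 + \sum_(i < m) \sum_(j < m) `|a i j|.
have ge0 i : 0 <= \sum_(j < m) `|a i j| by apply: sumr_ge0.
have lt_t i j : (i < m)%N -> (j < m)%N -> `|a i j| < t.
  move=> im jm; rewrite -[ltLHS]add0r; apply: ltr_leD => //.
  rewrite (bigD1 (Ordinal im)) //= (bigD1 (Ordinal jm)) //= -addrA lerDl.
  by rewrite addr_ge0 // sumr_ge0.
have t0 : 0 < t by rewrite ltr_wpDr // sumr_ge0.
exists t => [|i j im jm]; first by rewrite gt_eqF.
have := lt_t i j im jm.
rewrite addr_eq0 subr_eq0 => lt.
apply/andP; split; apply/eqP => e; move: lt; rewrite e ?normrN ger0_norm ?ltW //.
- by rewrite ltxx.
- by rewrite ltxx.
Qed.

(* In the step, [x = (0, 1, .., 1, 0, ..)] (ones at 1, .., s) and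
   [y = (-1, 0, t, .., t, 0, ..)] ([t] at 2, .., s+1) are the two new rows; on the
   old indices the wedge only changes entries by [t] or [-t] inside the band,
   which keeps them nonzero for [t] large. *)
Lemma band_wedge_sum q s : (0 < s)%N ->
  exists x y : nat -> nat -> F, forall i j : nat,
    (i < s + 2 + 2 * q)%N -> (j < s + 2 + 2 * q)%N ->
    (wedge_sum q.+1 x y i j != 0) = band s i j.
Proof.
move=> s0; elim: q => [|q [x [y xy]]].
  (* The entry is a difference of residues modulo [s + 1]. Among the indices [0, .., s + 1] only 0
     and [s + 1] share a residue, and they are the only distinct pair outside the band. *)
  exists (fun _ _ => 1), (fun _ i => (i %% s.+1)%:R) => i j hi hj.
  rewrite /wedge_sum big_ord1 mul1r mulr1 subr_eq0 eqr_nat /band.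
  have md k : (k < s + 2 + 2 * 0)%N -> (k %% s.+1 = if k == s.+1 then 0 else k)%N.
    by case: eqP => [->|k_s hk]; rewrite ?modnn // modn_small //; lia.
  by rewrite !md //; do 2!case: ifP; lia.
have [t t0 ht] := big_nat_bound (s + 2 + 2 * q) (wedge_sum q.+1 x y).
pose x0 (i : nat) : F := ((0 < i)%N && (i <= s)%N)%:R.
pose y0 (i : nat) : F := if i is i'.+1 then
  (if (0 < i')%N && (i' <= s)%N then t else 0) else -1.
(* Term 0 is the new vector; the old vectors move two indices up and vanish on the two new ones. *)
pose shift (v0 : nat -> F) (v : nat -> nat -> F) (l i : nat) : F :=
  if l is l'.+1 then (if i is i'.+2 then v l' i' else 0) else v0 i.
exists (shift x0 x), (shift y0 y).
have recE i j : wedge_sum q.+2 (shift x0 x) (shift y0 y) i j =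
  x0 i * y0 j - y0 i * x0 j +
  wedge_sum q.+1 (fun l => shift x0 x l.+1) (fun l => shift y0 y l.+1) i j.
  by rewrite /wedge_sum big_ord_recl.
have bandC i j : band s i j = band s j i.
  by rewrite /band eq_sym; congr (_ && _); rewrite andbC.
move=> i j; wlog ij : i j / (i <= j)%N => [hwlog hi hj|].
  have [ij|/ltnW ji] := leqP i j; first exact: hwlog.
  by rewrite wedge_sumC oppr_eq0 bandC hwlog.
(* Row 0 reduces to [x0 j] and row 1 to [y0 j]. *)
rewrite recE; case: i ij => [|[|i]] ij hi hj.
- rewrite wedge_sum0 // addr0 /x0 /y0 /= mul0r sub0r mulN1r opprK /band.
  by case: (boolP (_ && _)) => h; rewrite ?oner_eq0 ?eqxx /=; lia.
- rewrite wedge_sum0 // addr0 /x0 /y0 /= s0 mul0r subr0 mul1r /band.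
  case: j ij hj => // j _ hj.
  by case: (boolP (_ && _)) => h; rewrite ?t0 ?eqxx /=; lia.
case: j ij hj => [|[|j]] // ij hj.
have -> : band s i.+2 j.+2 = band s i j by rewrite /band; lia.
have hi' : (i < s + 2 + 2 * q)%N by lia.
have hj' : (j < s + 2 + 2 * q)%N by lia.
rewrite -xy // -[wedge_sum _ _ _ i.+2 _]/(wedge_sum q.+1 x y i j) /x0 /y0 /=.
(* For [i <= j] the two products cancel when [j + 2 <= s] and vanish when [j >= s]. Only [j = s - 1]
   with [i < j] gains [t]. *)
have [js|sj] := leqP j.+2 s.
  have -> : (i < s)%N by lia.
  have -> : (i.+1 < s)%N by lia.
  have -> : (j < s)%N by lia.
  by rewrite mul1r mulr1 subrr add0r.
have [/= js|js] := eqVneq j.+1 s; last first.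
  have -> : (j < s)%N = false by lia.
  by rewrite !mulr0 subrr add0r.
have -> : (j < s)%N by lia.
have [iS|Si] := ltnP i.+1 s; last first.
  by rewrite mul0r mulr0 subrr add0r.
rewrite mul1r mulr0 subr0 addrC.
have /andP[-> _] := ht i j hi' hj'.
by rewrite xy // /band; lia.
Qed.

End SkewRank.

Arguments wedge_sum {F}.

(* The least positive even number that is at least [m - s]. *)
Definition band_rank (s m : nat) : nat := (2 * ((m - s - 1)./2).+1)%N.

(** * Assembling the two parity classes *)

Section ParityClasses.
Variables (R : realType) (n s : nat).

(* Number of vertices [i < n] with [odd i = b]. *)
Definition class_size (b : bool) : nat := (n + ~~ b)./2.

Lemma skew_band_ex (b : bool) : (0 < s)%N ->
  exists W : 'M[R]_n, [/\ (\rank W <= band_rank s (class_size b))%N, W^T = - W &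
    forall i j : 'I_n, (W i j != 0) =
      [&& odd i == b, odd j == b & band s i./2 j./2]].
Proof.
(* This [q] is the least with [m <= s + 2 + 2 * q], the order reached by [q.+1] wedges. *)
move=> s0; set m := class_size b; set q := (m - s - 1)./2.
have [x [y xy]] := @band_wedge_sum R q s s0.
pose X (v : nat -> nat -> R) : 'M[R]_(q.+1, n) :=
  \matrix_(l, i) (if odd i == b then v l i./2 else 0).
pose W := (X x)^T *m X y - (X y)^T *m X x.
have le_q (Y Z : 'M[R]_(q.+1, n)) : (\rank (Y^T *m Z) <= q.+1)%N.
  exact: mulmx_max_rank.
exists W; split.
- rewrite /band_rank mul2n -addnn (leq_trans (mxrank_add _ _)) // mxrank_opp.
  exact: leq_add.
- by rewrite /W linearB /= !trmx_mul !trmxK opprB.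
move=> i j.
have -> : W i j = if (odd i == b) && (odd j == b) then
    wedge_sum q.+1 x y i./2 j./2 else 0.
  rewrite !mxE -sumrB; case: ifP => ij; last first.
    apply: big1 => l _; rewrite !mxE; move: ij.
    by do 2!case: eqP => //=; rewrite ?mul0r ?mulr0 subrr.
  by case/andP: ij => io jo; apply: eq_bigr => l _; rewrite !mxE io jo.
have bound (k : 'I_n) : odd k == b -> (k./2 < s + 2 + 2 * q)%N.
  by move=> /eqP kb; have := ltn_ord k; rewrite /q /m /class_size -kb; lia.
rewrite andbA; case: ifP => [/andP[io jo]|_]; last by rewrite eqxx.
by rewrite xy ?bound.
Qed.

(** Skew symmetry forces a zero diagonal, so the off-diagonal pattern extends to all entries. *)
Lemma skew_power_entryE (A : 'M[R]_n) : (1 < n)%N ->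
  skew_matrices R (strict_power (path_graph n) (2 * s)) A ->
  forall i j, (A i j != 0) = (odd i == odd j) && band s i./2 j./2.
Proof.
move=> n1 [skA adjA] i j; rewrite -strict_power_pathE //.
have [->|/adjA //] := eqVneq i j.
rewrite adj_irr; apply/negbTE; rewrite negbK.
move/matrixP/(_ j j)/eqP: skA.
by rewrite !mxE -addr_eq0 -mulr2n mulrn_eq0.
Qed.

Definition parity_proj (b : bool) : 'M[R]_n :=
  diag_mx (\row_i (odd i == b)%:R).

Lemma parity_proj_mulE b (A : 'M[R]_n) i j :
  (parity_proj b *m A) i j = (odd i == b)%:R * A i j.
Proof. by rewrite mul_diag_mx !mxE. Qed.

Lemma mul_parity_projE b (A : 'M[R]_n) i j :
  (A *m parity_proj b) i j = A i j * (odd j == b)%:R.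
Proof. by rewrite mul_mx_diag !mxE. Qed.

Lemma skew_power_rank_ge (A : 'M[R]_n) : (3 < n)%N -> (0 < s)%N ->
  skew_matrices R (strict_power (path_graph n) (2 * s)) A ->
  (band_rank s (class_size false) + band_rank s (class_size true) <= \rank A)%N.
Proof.
move=> n3 s0 hA; have AE := skew_power_entryE _ (ltnW (ltnW n3)) hA.
have skA := hA.1.
have comm b : parity_proj b *m A = A *m parity_proj b.
  apply/matrixP => i j; rewrite parity_proj_mulE mul_parity_projE mulrC.
  have [->|] := eqVneq (A i j) 0; first by rewrite !mul0r.
  by rewrite AE => /andP[/eqP -> _].
rewrite (rank_proj_split _ _ A (parity_proj false) (parity_proj true)) //; first last.
- apply/matrixP => i j; rewrite parity_proj_mulE !mxE.
  by case: (odd i); rewrite ?mul0r ?mul1r ?mul0rn.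
- apply/matrixP => i j; rewrite !mxE.
  by case: (odd i); rewrite /= ?mul0rn ?add0r ?addr0.
suff ge b : (band_rank s (class_size b) <= \rank (parity_proj b *m A))%N.
  exact: leq_add.
set B := parity_proj b *m A.
have evB : ~~ odd (\rank B).
  apply: skew_rank_even.
  by rewrite trmx_mul skA tr_diag_mx mulNmx -comm.
have lt_n u : (u < class_size b)%N -> (2 * u + b < n)%N.
  by rewrite /class_size; case: (b); lia.
have BE i j : (B i j != 0) = [&& odd i == b, odd j == b & band s i./2 j./2].
  rewrite parity_proj_mulE; case: (boolP (odd i == b)) => [/eqP <-|_].
    by rewrite mul1r AE [odd j == _]eq_sym.
  by rewrite mul0r eqxx.
have oddE u : odd (2 * u + b) = b by case: (b); lia.
have halfE u : ((2 * u + b)./2 = u)%N by case: (b); lia.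
(* As [n >= 4], each class has two vertices, and its first two are adjacent since [s >= 1]. *)
have rank1 : (0 < \rank B)%N.
  have h0 : (2 * 0 + b < n)%N by case: (b); lia.
  have h1 : (2 * 1 + b < n)%N by case: (b); lia.
  rewrite lt0n mxrank_eq0; apply/eqP => /matrixP /(_ (Ordinal h0) (Ordinal h1)) /eqP.
  by apply/negP; rewrite [X in _ == X]mxE BE /= !oddE !halfE eqxx /band; lia.
have rank2 : (class_size b - s <= \rank B)%N.
  have hf (i : 'I_(class_size b - s)) : (2 * i + b < n)%N.
    by apply: lt_n; have := ltn_ord i; lia.
  have hg (i : 'I_(class_size b - s)) : (2 * (i + s) + b < n)%N.
    by apply: lt_n; have := ltn_ord i; lia.
  (* Row [i] meets column [i + s] at distance exactly [s], and column [j + s] with [i < j] beyond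
     the band. *)
  apply: (rank_ge_triangular _ _ _ _ B (fun i => Ordinal (hf i)) (fun i => Ordinal (hg i))).
    by move=> i; rewrite BE /= !oddE !halfE eqxx /band; lia.
  by move=> i j ij; apply/eqP/negPn; rewrite BE /= !oddE !halfE /band; lia.
by rewrite /band_rank; lia.
Qed.

Lemma min_skew_rank_power : (3 < n)%N -> (0 < s)%N ->
  min_skew_rank R (strict_power (path_graph n) (2 * s)) =
  (band_rank s (class_size false) + band_rank s (class_size true))%N.
Proof.
move=> n3 s0; rewrite /min_skew_rank; case: ex_minnP => k /asboolP[A hA <-] min.
apply/eqP; rewrite eqn_leq skew_power_rank_ge // andbT.
have [W0 [rk0 sk0 W0E]] := skew_band_ex false s0.
have [W1 [rk1 sk1 W1E]] := skew_band_ex true s0.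
apply: leq_trans (leq_trans (mxrank_add W0 W1) (leq_add rk0 rk1)).
(* The supports of [W0] and [W1] are disjoint, so nothing cancels in the sum. *)
apply: min; apply/asboolP; exists (W0 + W1) => //; split.
  by rewrite linearD /= sk0 sk1 opprD.
move=> i j _; rewrite strict_power_pathE ?mxE; last by apply: ltnW (ltnW n3).
have := W0E i j; have := W1E i j.
case: (odd i) (odd j) => [] [] /=.
- by move=> <- /negbFE/eqP ->; rewrite add0r.
- by move=> /negbFE/eqP -> /negbFE/eqP ->; rewrite add0r eqxx.
- by move=> /negbFE/eqP -> /negbFE/eqP ->; rewrite add0r eqxx.
- by move=> /negbFE/eqP -> <-; rewrite addr0.
Qed.

End ParityClasses.

Local Close Scope ring_scope.

Theorem mainTheorem5 (R : realType) (n r s : nat)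
    (hn : 4 <= n) (hr : 0 < r) (hs : 0 < s) (hrs : r = 2 * s) :
  [/\ 1 <= r <= n - 3 -> odd n ->
        min_skew_rank R (strict_power (path_graph n) r) = n - r + 1,
      forall t : nat, 1 <= r <= n - 3 -> n = 2 * t -> ~~ odd (t - s) ->
        min_skew_rank R (strict_power (path_graph n) r) = n - r,
      forall t : nat, 1 <= r <= n - 3 -> n = 2 * t -> odd (t - s) ->
        min_skew_rank R (strict_power (path_graph n) r) = n - r + 2
    & n - 2 <= r ->
        min_skew_rank R (strict_power (path_graph n) r) = 4].
Proof.
(* If [r <= n - 3], each class size minus [s] is positive and is rounded up to an even number:
   exactly one of the two for odd [n], both or neither for [n = 2t]. If [r >= n - 2], each class
   contributes 2. *)
rewrite hrs min_skew_rank_power // /band_rank /class_size /=.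
by split=> [|t|t|]; lia.
Qed.
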